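(* Let $d\geq 1$, let $t_1,\ldots,t_M\in[0,1)^d$ be pairwise different, and let $z_j$ and $\lambda_j(\mu)$ be defined as in the context. Let $i\neq j$ in $\{1,\ldots,M\}$ be fixed and suppose $\epsilon\in[0,1]$. If $\mu\in\mathbb{S}_{\mathbb{C}}^{d-1}$ is a random vector, distributed according to the unitarily invariant probability measure on $\mathbb{S}_{\mathbb{C}}^{d-1}$, then the probability that $$|\lambda_i(\mu)-\lambda_j(\mu)|<\epsilon\,\|z_i-z_j\|$$ holds is at most $2\sqrt{\frac{d}{\pi}}\,\epsilon$.
   Context: $\langle x,y\rangle=\sum_{\ell=1}^d x_\ell\overline{y_\ell}$ is the standard inner product on $\mathbb{C}^d$, $\|\cdot\|$ is the Euclidean norm, and $\mathbb{S}_{\mathbb{C}}^{d-1}=\{x\in\mathbb{C}^d:\|x\|=1\}$ is the complex unit sphere. For $t_1,\ldots,t_M\in[0,1)^d$ put $$z_j:=(e^{-2\pi i t_{j,1}},\ldots,e^{-2\pi i t_{j,d}})\in\mathbb{C}^d,\qquad \lambda_j(\mu):=\langle z_j,\mu\rangle,\quad \mu\in\mathbb{C}^d,\ j=1,\ldots,M.$$ (In the exponents $i$ denotes the imaginary unit.) *)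

(* Defs.v *)
From HB Require Import structures.
From mathcomp Require Import all_boot all_order all_algebra.
From mathcomp Require Import spectral complex.
From mathcomp Require Import all_classical all_reals all_analysis.

Set Implicit Arguments.
Unset Strict Implicit.
Unset Printing Implicit Defensive.

Import Order.TTheory GRing.Theory Num.Theory.
Import numFieldNormedType.Exports.

Local Open Scope classical_set_scope.
Local Open Scope complex_scope.
Local Open Scope ring_scope.

(* The topology of R[i] given by the modulus; 'rV[R[i]]_d then carries the
   product topology, which is the usual topology of C^d. *)
HB.instance Definition _ (R : realType) := NormedModule.copy R[i] R[i]^o.

(* C^d with its Borel sigma-algebra. *)
Notation borelC R d := (g_sigma_algebraType (@open 'rV[R[i]]_d)).

Section Defs.
Context {R : realType}.

Definition cexp (z : R[i]) : R[i] :=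
  (expR (complex.Re z))%:C * (cos (complex.Im z) +i* sin (complex.Im z)).

Section Dimension.
Context {d : nat}.

(* dotmx u v = \sum_l u_l * (v_l)^*, conjugate-linear in the second argument. *)
Definition eucl_norm (x : 'rV[R[i]]_d) : R[i] := sqrtC (dotmx x x).

Definition csphere : set 'rV[R[i]]_d := [set x | eucl_norm x = 1].

(* The unitarily invariant probability measure of the sphere, as a Borel
   measure on C^d carried by the sphere; these properties determine Q.
   Vectors are rows, so a unitary matrix acts by right multiplication. *)
Definition unitarily_invariant_on_sphere (Q : probability (borelC R d) R) :=
  Q csphere = 1%E /\
  forall U : 'M[R[i]]_d, U \is unitarymx ->
    forall A : set (borelC R d), measurable A ->
      Q [set x : 'rV[R[i]]_d | A (x *m U)] = Q A.

Definition zvec (t : 'rV[R]_d) : 'rV[R[i]]_d :=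
  \row_l cexp (- (2 * pi * t 0 l)%:C * 'i).

Definition lambda (t : 'rV[R]_d) (mu : 'rV[R[i]]_d) : R[i] :=
  dotmx (zvec t) mu.

End Dimension.
End Defs.

(* Main.v *)
From HB Require Import structures.
Require Import Defs.
From mathcomp Require Import all_boot all_order all_algebra.
From mathcomp Require Import spectral complex.
From mathcomp Require Import all_classical all_reals all_analysis.
From mathcomp Require Import measurable_realfun ring lra.

(** With [w = z_i - z_j] the event reads [|<w, mu>| < eps |w|].  It is empty when
[w = 0]; otherwise it says that [X_u := |<u, mu>|^2 < eps^2] for the unit
vector [u = w / |w|], so everything rests on the law of [X_u] in dimension
[d = n + 1].  For [n = 0] it is the point mass at one, so the event has
probability zero; for [n > 0] it is Beta(1, n), and
[P (X_u < s) = 1 - (1 - s)^n <= n s].  The proof derives this from unitary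
invariance alone, through moments.

- A unitary matrix sends [u] to the first basis vector, so the law of [X_u] is
  that of [X := |mu_0|^2] for every unit [u] ([sqdot_law]), and by homogeneity
  [E |<a, mu>|^2k = |a|^2k E X^k] for every [a <> 0] ([sqdot_moment]).
- Apply this to [a = e_0 + r z e_l] with [r] real and [z = 1] or [z = i].
  Both sides are polynomials in [r]; comparing the coefficients of [r^2] and
  adding the two cases gives [(k+1) E (X^k |mu_l|^2) = E X^(k+1)]
  ([mixed_moment]).  Summing over [l] on the sphere gives the recursion
  [(n+1+k) E X^(k+1) = (k+1) E X^k] ([moment_rec]).
- This recursion says that [E ((1 - (n+1) X) g(X) + X (1 - X) g'(X)) = 0] for
  every polynomial [g] ([jacobi_stein]); the choice [g = (1 - X)^k] yields
  [E (1 - X)^k = n / (n + k)] ([jacobi_moments]).  So [V := (1 - X)^n] has the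
  moments [1 / (k+1)] of the uniform law on [[0, 1]].
- A variable in [[0, 1]] with these moments is uniform: all Bernstein
  polynomials of degree [N] have the same mean [1 / (N+1)] in [V]
  ([bernstein_mean]), and a sum of them approximates the indicator of [[v, 1]]
  by Chebyshev's inequality, whence [P (V >= v) <= 1 - v] ([uniform_tail]).

Finally a probability [p <= n eps^2] satisfies [p^2 <= p <= n eps^2], and
[pi <= 4] makes [sqrt n eps] at most [2 sqrt (d / pi) eps].

Expectations are taken over a set [D] of measure one rather than over the
whole space, because the coordinates of [mu] are bounded on the sphere only. *)

Set Implicit Arguments.
Unset Strict Implicit.
Unset Printing Implicit Defensive.

Import Order.TTheory GRing.Theory Num.Theory.
Import numFieldNormedType.Exports.

Local Open Scope classical_set_scope.
Local Open Scope complex_scope.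
Local Open Scope ring_scope.

(** * Expectation of bounded random variables *)

Section BoundedMeasurable.
Context (R : realType) (dT : measure_display) (T : measurableType dT).
Context (P : probability T R) (D : set T).
Hypotheses (mD : measurable D) (PD : P D = 1%E).

Definition bounded_meas (f : T -> R) :=
  measurable_fun D f /\ exists M, forall x, D x -> `|f x| <= M.

Local Notation E f := (\int[P]_(x in D) f x).

Lemma bounded_meas_integrable f : bounded_meas f ->
  P.-integrable D (EFin \o f).
Proof.
move=> [mf [M Mf]]; apply: measurable_bounded_integrable => //.
  by rewrite [ltLHS]PD ltry.
exists M; split; first exact: num_real.
by move=> y My x Dx; apply: (le_trans (Mf x Dx)); exact: ltW.
Qed.

Lemma bounded_meas_cst c : bounded_meas (fun=> c).
Proof. by split; [exact: measurable_cst|exists `|c|]. Qed.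

Lemma bounded_measD f g :
  bounded_meas f -> bounded_meas g -> bounded_meas (fun x => f x + g x).
Proof.
move=> [mf [M Mf]] [mg [N Ng]]; split; first exact: measurable_funD.
exists (M + N) => x Dx; rewrite (le_trans (ler_normD _ _))//.
by rewrite lerD ?Mf ?Ng.
Qed.

Lemma bounded_measM f g :
  bounded_meas f -> bounded_meas g -> bounded_meas (fun x => f x * g x).
Proof.
move=> [mf [M Mf]] [mg [N Ng]]; split; first exact: measurable_funM.
by exists (M * N) => x Dx; rewrite normrM ler_pM ?Mf ?Ng.
Qed.

Lemma bounded_measX f n : bounded_meas f -> bounded_meas (fun x => f x ^+ n).
Proof.
move=> bf; elim: n => [|n IH].
  by rewrite (_ : (fun _ => _) = fun=> 1)//; exact: bounded_meas_cst.
rewrite (_ : (fun x => f x ^+ n.+1) = (fun x => f x * f x ^+ n)).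
  exact: bounded_measM.
by apply/funext => x; rewrite exprS.
Qed.

Lemma bounded_meas_sum (I : Type) (s : seq I) (f : I -> T -> R) :
  (forall i, bounded_meas (f i)) ->
  bounded_meas (fun x => \sum_(i <- s) f i x).
Proof.
move=> bf; elim: s => [|i s IH].
  rewrite (_ : (fun _ => _) = fun=> 0); first exact: bounded_meas_cst.
  by apply/funext => x; rewrite big_nil.
rewrite (_ : (fun _ => _) = fun x => f i x + \sum_(i <- s) f i x).
  exact: bounded_measD.
by apply/funext => x; rewrite big_cons.
Qed.

Lemma bounded_meas_horner f (p : {poly R}) :
  bounded_meas f -> bounded_meas (fun x => p.[f x]).
Proof.
move=> bf; rewrite (_ : (fun _ => _) = fun x => \sum_(i < size p) p`_i * f x ^+ i).
  apply: bounded_meas_sum => i; apply: bounded_measM.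
    exact: bounded_meas_cst.
  exact: bounded_measX.
by apply/funext => x; rewrite horner_coef.
Qed.

Lemma measurable_preimage_lt (f : T -> R) s :
  measurable_fun setT f -> measurable [set x | f x < s].
Proof.
move=> mf; rewrite -preimage_itvNyo -[X in measurable X]setTI.
by apply: mf => //; exact: measurable_itv.
Qed.

Lemma measure_setI_full (A : set T) : measurable A -> P (D `&` A) = P A.
Proof.
have PDc : P (~` D) = 0%E by rewrite probability_setC// PD subee.
move=> mA; have PAD : P (A `\` D) = 0%E.
  by apply: (subset_measure0 _ (measurableC mD)) => //; exact: measurableD.
apply/esym; apply: etrans (measureDI P mA mD) _.
by rewrite [X in (X + _)%E]PAD add0e setIC.
Qed.

Lemma expect_cst c : E (fun=> c) = c.
Proof. by rewrite Rintegral_cst// [X in fine X]PD /= mulr1. Qed.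

Lemma expectD f g : bounded_meas f -> bounded_meas g ->
  E (fun x => f x + g x) = E f + E g.
Proof. by move=> bf bg; rewrite RintegralD//; exact: bounded_meas_integrable. Qed.

Lemma expectZ c f : bounded_meas f -> E (fun x => c * f x) = c * E f.
Proof. by move=> bf; rewrite RintegralZl//; exact: bounded_meas_integrable. Qed.

Lemma expectZr c f : bounded_meas f -> E (fun x => f x * c) = E f * c.
Proof. by move=> bf; rewrite RintegralZr//; exact: bounded_meas_integrable. Qed.

Lemma expect_sum (I : Type) (s : seq I) (f : I -> T -> R) :
  (forall i, bounded_meas (f i)) ->
  E (fun x => \sum_(i <- s) f i x) = \sum_(i <- s) E (f i).
Proof.
move=> bf; elim: s => [|i s IH].
  by rewrite big_nil; under eq_Rintegral do rewrite big_nil; rewrite expect_cst.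
rewrite big_cons -IH -expectD//; last exact: bounded_meas_sum.
by apply: eq_Rintegral => x _; rewrite big_cons.
Qed.

Lemma le_expect f g : bounded_meas f -> bounded_meas g ->
  (forall x, D x -> f x <= g x) -> E f <= E g.
Proof. by move=> bf bg fg; apply: le_Rintegral => //; exact: bounded_meas_integrable. Qed.

Lemma eq_expect f g : (forall x, D x -> f x = g x) -> E f = E g.
Proof. by move=> fg; apply: eq_Rintegral => x; rewrite inE; exact: fg. Qed.

(** This makes [p |-> E p(V)] a linear form, so that moment identities can be
proved on the polynomial side. *)
Lemma expect_horner_linear V : bounded_meas V ->
  scalar (fun p : {poly R} => E (fun x => p.[V x])).
Proof.
move=> bV a p q /=.
rewrite -expectZ; last exact: bounded_meas_horner.
rewrite -expectD; last 2 first.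
- by apply: bounded_measM; [exact: bounded_meas_cst|exact: bounded_meas_horner].
- exact: bounded_meas_horner.
by apply: eq_Rintegral => x _; rewrite hornerD hornerZ.
Qed.

(** Nonnegativity lets the integral of [X^k] be transported to the law of [X]
on the line; the complement of [D] has measure zero. *)
Lemma expect_law (X Y : T -> R) (k : nat) :
  measurable_fun setT X -> measurable_fun setT Y ->
  (forall x, 0 <= X x) -> (forall x, 0 <= Y x) ->
  (forall B : set R, measurable B -> P (X @^-1` B) = P (Y @^-1` B)) ->
  E (fun x => X x ^+ k) = E (fun x => Y x ^+ k).
Proof.
have PDc : P (~` D) = 0%E by rewrite probability_setC// PD subee.
suff suf (Z : T -> R) : measurable_fun setT Z -> (forall x, 0 <= Z x) ->
   (\int[P]_(x in D) (Z x ^+ k)%:E =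
    \int[pushforward P Z]_(y in setT) (`|y| ^+ k)%:E)%E.
  move=> mX mY X0 Y0 XY; rewrite /Rintegral !suf//; congr fine.
  by apply: eq_measure_integral => A mA _; exact: XY.
move=> mZ Z0; rewrite ge0_integral_pushforward//; last first.
  by apply/measurable_EFinP; apply: measurable_funX; exact: normr_measurable.
rewrite preimage_setT (ge0_negligible_integral (measurableC mD))//.
- rewrite setTD setCK; apply: eq_integral => x _ /=.
  by rewrite ger0_norm.
- apply/measurable_EFinP; apply: measurable_funX; exact: measurableT_comp.
- by move=> y _; rewrite lee_fin exprn_ge0.
Qed.

End BoundedMeasurable.

(** * Uniform moments characterise the uniform law *)

Section Bernstein.
Context (R : realFieldType).

Definition bernstein (n k : nat) : {poly R} :=
  'C(n, k)%:R *: ('X^k * (1 - 'X) ^+ (n - k)).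

(** The fundamental theorem of calculus on [[0, 1]], for a linear form that
agrees with the Lebesgue integral on monomials. *)
Lemma uniform_deriv (L : {scalar {poly R}}) :
  (forall k, L 'X^k = k.+1%:R^-1) -> forall p, L p^`() = p.[1] - p.[0].
Proof.
move=> LX p; rewrite -(coefK p) poly_def !raddf_sum/=.
rewrite !horner_sum -sumrB; apply: eq_bigr => i _.
rewrite derivZ linearZ/= derivXn !hornerE expr1n.
case: (nat_of_ord i) => [|k]; first by rewrite mulr0n raddf0 expr0; ring.
by rewrite /= raddfMn/= LX expr0n/= -[_^-1 *+ _]mulr_natr mulVf ?pnatr_eq0//; ring.
Qed.

(** Integration by parts: the derivative of [X^(k+1) (1 - X)^(n-k)] has mean
zero and is a multiple of [b_(n,k) - b_(n,k+1)].  The mean of [b_(n,0)] comes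
from the derivative of [(1 - X)^(n+1)]. *)
Lemma bernstein_mean (L : {scalar {poly R}}) :
  (forall k, L 'X^k = k.+1%:R^-1) ->
  forall n k, (k <= n)%N -> L (bernstein n k) = n.+1%:R^-1.
Proof.
move=> LX n; elim=> [_|k IH kn].
  have := uniform_deriv LX ((1 - 'X) ^+ n.+1)%R.
  rewrite deriv_exp/= !hornerE/= subrr expr0n/= subr0 expr1n sub0r.
  rewrite derivB derivC derivX sub0r mulN1r mulNrn raddfN raddfMn /=.
  rewrite /bernstein bin0 scale1r subn0 expr0 mul1r.
  move/oppr_inj => h; apply: (mulIf (_ : n.+1%:R != 0)); first by rewrite pnatr_eq0.
  by rewrite mulr_natr h mulVf// pnatr_eq0.
rewrite -(IH (ltnW kn)).
have := uniform_deriv LX ('X^(k.+1) * (1 - 'X) ^+ (n - k))%R.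
rewrite -(subnSK kn).
rewrite !hornerE/= subrr expr0n/= mulr0 expr0n/= mul0r subr0.
move/(congr1 (fun x => 'C(n, k)%:R * x)); rewrite mulr0.
have kC : (k.+1%:R * 'C(n, k.+1)%:R = (n - k.+1).+1%:R * 'C(n, k)%:R :> R).
  by rewrite -!natrM mul_bin_left subnSK.
have -> : ('X^(k.+1) * (1 - 'X) ^+ (n - k.+1).+1 : {poly R})^`() =
  k.+1%:R *: ('X^k * (1 - 'X) ^+ (n - k)) -
  (n - k.+1).+1%:R *: ('X^(k.+1) * (1 - 'X) ^+ (n - k.+1)).
  rewrite derivM derivXn deriv_exp derivB derivC derivX /= -(subnSK kn).
  by rewrite !scaler_nat; ring.
rewrite linearB /= /bernstein (scalarZ L k.+1%:R) (scalarZ L (n - k.+1).+1%:R) !scalarZ.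
rewrite mulrBr => /eqP; rewrite subr_eq0 => /eqP h.
apply: (mulfI (_ : k.+1%:R != 0)); first by rewrite pnatr_eq0.
by rewrite mulrA kC -mulrA mulrCA -h mulrCA.
Qed.

(** Conditioning a binomial variable on its first trial. *)
Lemma bernstein_recl n (phi : nat -> R) (x : R) :
  \sum_(k < n.+2) (bernstein n.+1 k).[x] * phi k =
  (1 - x) * (\sum_(k < n.+1) (bernstein n k).[x] * phi k) +
  x * (\sum_(k < n.+1) (bernstein n k).[x] * phi k.+1).
Proof.
rewrite /bernstein big_ord_recl.
under eq_bigr => k _ do
  rewrite lift0 binS natrD scalerDl hornerD mulrDl subSS.
rewrite big_split/= addrA; congr (_ + _); last first.
  rewrite mulr_sumr; apply: eq_bigr => k _.
  by rewrite !hornerE exprS /=; ring.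
rewrite [in LHS]big_ord_recr /= (bin_small (ltnSn n)) scale0r horner0 mul0r addr0.
rewrite [in RHS]big_ord_recl mulrDr; congr (_ + _).
  by rewrite !bin0 !subn0 !hornerE exprS /=; ring.
rewrite mulr_sumr; apply: eq_bigr => k _.
rewrite lift0 !hornerE -(subnSK (ltn_ord k)) !exprS /=; ring.
Qed.

Lemma bernstein_sum1 n (x : R) : \sum_(k < n.+1) (bernstein n k).[x] = 1.
Proof.
elim: n => [|n IH].
  by rewrite big_ord1 /bernstein bin0 scale1r subnn !expr0 mul1r hornerC.
have := bernstein_recl n (fun=> 1) x.
under eq_bigr do rewrite mulr1; move=> ->.
by under eq_bigr do rewrite mulr1; rewrite IH; ring.
Qed.

(** The second moment about an arbitrary centre [c], because the induction
replaces [c] by [c - 1]; for [c = n x] it is the binomial variance. *)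
Lemma bernstein_variance n (x c : R) :
  \sum_(k < n.+1) (bernstein n k).[x] * (k%:R - c) ^+ 2 =
  (n%:R * x - c) ^+ 2 + n%:R * x * (1 - x).
Proof.
elim: n c => [|n IH] c.
  rewrite big_ord1 /bernstein bin0 scale1r subnn !expr0 mul1r hornerC /=; ring.
rewrite (bernstein_recl n (fun k => (k%:R - c) ^+ 2)) IH.
rewrite (eq_bigr (fun k : 'I_n.+1 =>
    (bernstein n k).[x] * (k%:R - (c - 1)) ^+ 2)); last first.
  by move=> k _; rewrite -natr1; ring.
by rewrite IH -natr1; ring.
Qed.

Lemma bernstein_ge0 n k (x : R) : 0 <= x <= 1 -> 0 <= (bernstein n k).[x].
Proof.
by move=> /andP[x0 x1]; rewrite !hornerE !mulr_ge0 ?exprn_ge0 ?subr_ge0.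
Qed.

(** Chebyshev's inequality for the binomial law of parameters [n] and [x]: the
mean [n x] is at distance at least [n v - K] from every [k < K], and the
variance [n x (1 - x)] is at most [n / 4]. *)
Lemma bernstein_tail n K (v x : R) : 0 <= x <= 1 -> v <= x ->
  K%:R < n%:R * v ->
  1 - n%:R / 4 / (n%:R * v - K%:R) ^+ 2 <=
  \sum_(k < n.+1) (bernstein n k).[x] * (K <= k)%N%:R.
Proof.
move=> x01 vx Kv; rewrite lerBlDl.
have d0 : 0 < n%:R * v - K%:R by rewrite subr_gt0.
rewrite -[leLHS](bernstein_sum1 n x) -lerBlDr -sumrB.
apply: (@le_trans _ _ (\sum_(k < n.+1) (bernstein n k).[x] *
   (k%:R - n%:R * x) ^+ 2 / (n%:R * v - K%:R) ^+ 2)).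
  apply: ler_sum => k _; rewrite -{1}[(bernstein n k).[x]]mulr1 -mulrBr -mulrA.
  apply: ler_wpM2l; first exact: bernstein_ge0.
  case: leqP => [_|kK]; first by rewrite subrr divr_ge0 ?sqr_ge0.
  rewrite subr0 ler_pdivlMr ?exprn_gt0// mul1r -[leRHS]sqrrN opprB.
  have kKR : k%:R < K%:R :> R by rewrite ltr_nat.
  have nvx : n%:R * v <= n%:R * x by rewrite ler_wpM2l.
  by rewrite lerXn2r ?nnegrE; lra.
rewrite -mulr_suml bernstein_variance subrr expr0n add0r.
rewrite ler_wpM2r ?invr_ge0 ?sqr_ge0// -mulrA ler_wpM2l//.
have := sqr_ge0 (x - 2^-1); move: x01; nra.
Qed.

End Bernstein.

Section UniformTail.
Context (R : realType) (dT : measure_display) (T : measurableType dT).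
Context (P : probability T R) (D : set T).
Hypotheses (mD : measurable D) (PD : P D = 1%E).
Local Notation E f := (\int[P]_(x in D) f x).

Lemma measurable_preimage_ge (V : T -> R) v : measurable_fun D V ->
  measurable (D `&` [set x | v <= V x]).
Proof.
by move=> mV; rewrite -preimage_itvcy; apply: mV => //; exact: measurable_itv.
Qed.

Lemma bounded_meas_indic (A : set T) : measurable A ->
  bounded_meas D (\1_A : T -> R).
Proof.
move=> mA; split; first exact: measurable_indic.
by exists 1 => x _; rewrite indicE ger0_norm// lern1 leq_b1.
Qed.

(** Integrate [bernstein_tail] in [V]: the sum of the [b_(n,k)] with [K <= k] is
nonnegative everywhere, close to one where [v <= V], and its mean counts the
admissible [k]. *)
Lemma uniform_tail_approx (V : T -> R) v n K :
  measurable_fun D V -> (forall x, D x -> 0 <= V x <= 1) ->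
  (forall k, E (fun x => V x ^+ k) = k.+1%:R^-1) ->
  (K <= n)%N -> K%:R < n%:R * v ->
  fine (P (D `&` [set x | v <= V x])) *
    (1 - n%:R / 4 / (n%:R * v - K%:R) ^+ 2) <= (n.+1 - K)%:R / n.+1%:R.
Proof.
move=> mV V01 EV Kn Kv.
have bV : bounded_meas D V.
  split=> //; exists 1 => x /V01/andP[V0 V1].
  by rewrite ger0_norm.
pose Lm := GRing.isLinear.Build R {poly R} R *%R
  (fun p : {poly R} => E (fun x => p.[V x])) (expect_horner_linear mD PD bV).
pose L : {scalar {poly R}} := HB.pack (fun p : {poly R} => E (fun x => p.[V x])) Lm.
have LX k : L 'X^k = k.+1%:R^-1.
  by rewrite -EV; apply: eq_Rintegral => x _; rewrite hornerXn.
set A := D `&` _; set c := 1 - _.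
have mA : measurable A by exact: measurable_preimage_ge.
pose q := \sum_(K <= k < n.+1) bernstein R n k.
have qE x : q.[x] = \sum_(k < n.+1) (bernstein R n k).[x] * (K <= k)%N%:R.
  rewrite /q horner_sum big_geq_mkord [RHS](bigID (fun k : 'I_n.+1 => (K <= k)%N))/=.
  rewrite [X in _ + X]big1 ?addr0 => [|k /negbTE ->]; last by rewrite mulr0.
  by apply: eq_bigr => k ->; rewrite mulr1.
have -> : (n.+1 - K)%:R / n.+1%:R = L q.
  rewrite /q raddf_sum (eq_big_nat _ _ (F2 := fun=> n.+1%:R^-1)).
    by rewrite sumr_const_nat mulr_natl.
  by move=> k /andP[_ kn]; apply: (bernstein_mean LX); rewrite -ltnS.
have EA : E (\1_A : T -> R) = fine (P A).
  by rewrite /Rintegral integral_indic// setIAC setIid.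
rewrite -EA mulrC -expectZ//; last exact: bounded_meas_indic.
apply: le_expect => //.
- by apply: bounded_measM; [exact: bounded_meas_cst|exact: bounded_meas_indic].
- exact: bounded_meas_horner.
move=> x Dx; have Vx := V01 x Dx; rewrite indicE.
have [|_] := boolP (x \in A).
  rewrite inE => -[_ /= vV]; rewrite mulr1 qE.
  exact: bernstein_tail.
rewrite mulr0 qE sumr_ge0// => k _; rewrite mulr_ge0//.
exact: bernstein_ge0.
Qed.

(** Let [n] tend to infinity in [uniform_tail_approx] with [K] close to
[n (v - d)] for a small [d]. *)
Lemma uniform_tail (V : T -> R) v :
  measurable_fun D V -> (forall x, D x -> 0 <= V x <= 1) ->
  (forall k, E (fun x => V x ^+ k) = k.+1%:R^-1) -> v <= 1 ->
  fine (P (D `&` [set x | v <= V x])) <= 1 - v.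
Proof.
move=> mV V01 EV v1; set a := fine _.
have a01 : 0 <= a <= 1.
  rewrite fine_ge0//= -lee_fin fineK ?probability_le1//.
    exact: measurable_preimage_ge.
  apply: fin_num_measure; exact: measurable_preimage_ge.
apply/ler_addgt0Pr => e e0.
pose d := e / 4.
have d0 : 0 < d by rewrite divr_gt0.
have de : e = 4 * d by rewrite /d; field.
clearbody d.
have [vd|dv] := ltP v d; first by lra.
(* [n] exceeds [1/d] and [1/d^3]: the first absorbs the rounding of [K], the
   second makes the Chebyshev error at most [d]. *)
pose n := (Num.truncn (d^-1 + (d ^+ 3)^-1)).+1.
have nd : d^-1 + (d ^+ 3)^-1 < n%:R by exact: truncnS_gt.
pose K := Num.truncn (n%:R * (v - d)).
have nvd0 : 0 <= n%:R * (v - d) by rewrite mulr_ge0// subr_ge0.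
have Kle : K%:R <= n%:R * (v - d) by have /andP[] := truncn_itv nvd0.
have Kgt : n%:R * (v - d) < K%:R + 1.
  by rewrite natr1; have /andP[] := truncn_itv nvd0.
have n0 : (0 : R) < n%:R by rewrite ltr0n.
clearbody n K.
have Kv : K%:R < n%:R * v by nra.
have Kn : (K <= n)%N by rewrite -(ler_nat R); nra.
have := uniform_tail_approx mV V01 EV Kn Kv; rewrite -/a natrB ?leqW//.
have d30 : 0 < (d ^+ 3)^-1 by rewrite invr_gt0 exprn_gt0.
have di0 : 0 < d^-1 by rewrite invr_gt0.
have h1 : n%:R / 4 / (n%:R * v - K%:R) ^+ 2 <= d.
  rewrite ler_pdivrMr; last by rewrite exprn_gt0// subr_gt0.
  have ndlt : 1 < n%:R * d ^+ 3.
    by rewrite -ltr_pdivrMr ?exprn_gt0// div1r; lra.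
  have : (n%:R * d) ^+ 2 <= (n%:R * v - K%:R) ^+ 2.
    have nd0 : 0 <= n%:R * d by rewrite mulr_ge0// ltW.
    have ndK : n%:R * d <= n%:R * v - K%:R.
      by rewrite lerBrDr addrC -lerBrDr -mulrBr.
    by rewrite lerXn2r ?nnegrE ?(le_trans nd0).
  move/(ler_wpM2l (ltW d0)); apply: le_trans.
  rewrite (_ : d * (n%:R * d) ^+ 2 = n%:R * (n%:R * d ^+ 3)); last by ring.
  rewrite ler_wpM2l ?ltW//; lra.
rewrite ler_pdivlMr ?ltr0n//.
have nd1 : 1 < n%:R * d by rewrite -ltr_pdivrMr// div1r; lra.
set w := _ / 4 / _ in h1 *.
rewrite -[n.+1%:R]natr1 => h.
have aw : a * w <= d by move: a01; nra.
have : a * (n%:R + 1) <= n%:R + 1 - K%:R + d * (n%:R + 1).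
  have n10 : 0 <= n%:R + 1 :> R by rewrite addr_ge0// ltW.
  have := ler_wpM2r n10 aw; move: h.
  by rewrite mulrBr mulr1 mulrBl lerBlDr => h1' h2; rewrite (le_trans h1')// lerD2l.
rewrite -ler_pdivlMr ?ltr_wpDl// => /le_trans; apply.
rewrite ler_pdivrMr ?ltr_wpDl//.
by rewrite de; nra.
Qed.

End UniformTail.

(** * Beta moments and the tail of the Beta law *)

Section JacobiMoments.
Context (R : realFieldType) (m : nat) (L : {scalar {poly R}}).
Hypothesis LX : forall k, (m.+1 + k)%:R * L 'X^(k.+1) = k.+1%:R * L 'X^k.

(** The Stein identity of the Beta(1, m) law; on monomials [g] it is the moment
recursion. *)
Lemma jacobi_stein (g : {poly R}) :
  L ((1 - m.+1%:R *: 'X) * g + 'X * (1 - 'X) * g^`()) = 0.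
Proof.
rewrite -(coefK g) poly_def raddf_sum/= !mulr_sumr -big_split/= raddf_sum.
apply: big1 => i _; rewrite derivZ -!scalerAr -scalerDr /= (scalarZ L g`_i).
suff -> : L ((1 - m.+1%:R *: 'X) * 'X^i + 'X * (1 - 'X) * 'X^i^`()) = 0.
  by rewrite mulr0.
have -> : (1 - m.+1%:R *: 'X) * 'X^i + 'X * (1 - 'X) * 'X^i^`() =
  i.+1%:R *: 'X^i - (m.+1 + i)%:R *: 'X^(i.+1) :> {poly R}.
  rewrite derivXn; case: (nat_of_ord i) => [|k].
    by rewrite mulr0n addn0 !expr0 expr1 !scaler_nat; ring.
  by rewrite /= !scaler_nat !exprS; ring.
by rewrite linearB/= (scalarZ L i.+1%:R) (scalarZ L (m.+1 + i)%:R) LX subrr.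
Qed.

(** For [g = (1 - X)^k] the Stein identity relates two consecutive powers of
[1 - X] only. *)
Lemma jacobi_moments k : (0 < m)%N -> L 1 = 1 ->
  L ((1 - 'X) ^+ k) = m%:R / (m + k)%:R.
Proof.
move=> m0 L1; elim: k => [|k IH].
  by rewrite expr0 L1 addn0 divff// pnatr_eq0 -lt0n.
have mk0 j : (m + j)%:R != 0 :> R by rewrite pnatr_eq0 addn_eq0 negb_and -lt0n m0.
have := jacobi_stein ((1 - 'X) ^+ k).
have -> : (1 - m.+1%:R *: 'X) * (1 - 'X) ^+ k +
    'X * (1 - 'X) * ((1 - 'X) ^+ k)^`() =
    (m + k.+1)%:R *: (1 - 'X) ^+ k.+1 - (m + k)%:R *: (1 - 'X) ^+ k :> {poly R}.
  rewrite deriv_exp derivB derivC derivX !scaler_nat.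
  case: k {IH} => [|k]; first by rewrite !mulr0n !expr0 expr1; ring.
  by rewrite /= !exprS; ring.
rewrite linearB/= (scalarZ L (m + k.+1)%:R) (scalarZ L (m + k)%:R) IH.
rewrite mulrCA divff// mulr1 => /eqP; rewrite subr_eq0 => /eqP h.
by rewrite -h mulrAC divff// mul1r.
Qed.

End JacobiMoments.

(** Bernoulli's inequality. *)
Lemma onem_exp_le (R : realDomainType) (s : R) m :
  0 <= s <= 1 -> 1 - (1 - s) ^+ m <= m%:R * s.
Proof.
move=> /andP[s0 s1]; elim: m => [|m IH]; first by rewrite expr0; lra.
rewrite exprS -natr1.
have : (1 - s) ^+ m <= 1 by rewrite exprn_ile1; lra.
by have : 0 <= m%:R :> R by []; nra.
Qed.

(** A probability is at least its own square, which turns the bound quadratic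
in [e] into a linear one. *)
Lemma prob_le_sqrt_pi (R : realType) n (p e : R) : 0 <= p <= 1 -> 0 <= e ->
  p <= n%:R * e ^+ 2 -> p <= 2 * Num.sqrt (n.+1%:R / pi) * e.
Proof.
move=> /andP[p0 p1] e0 pe.
have pi0 : 0 < pi :> R := pi_gt0 R.
have pi4 : pi <= 4 :> R.
  by have /andP[_] := pihalf_02 R; lra.
rewrite -(ler_pXn2r (n := 2)) ?nnegrE ?mulr_ge0 ?sqrtr_ge0//.
rewrite !exprMn sqr_sqrtr; last by rewrite divr_ge0// ltW.
have pp : p ^+ 2 <= p by rewrite expr2 ler_piMl.
apply: (le_trans pp); apply: (le_trans pe).
rewrite ler_wpM2r ?sqr_ge0// mulrA ler_pdivlMr// -natr1.
by have : 0 <= n%:R :> R by []; nra.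
Qed.

Section BetaTail.
Context (R : realType) (dT : measure_display) (T : measurableType dT).
Context (P : probability T R) (D : set T).
Hypotheses (mD : measurable D) (PD : P D = 1%E).
Local Notation E f := (\int[P]_(x in D) f x).

(** [(1 - X)^m] is uniformly distributed and [X < s] forces it above
[(1 - s)^m]. *)
Lemma beta_tail (X : T -> R) (m : nat) (s : R) : (0 < m)%N ->
  measurable_fun D X -> (forall x, D x -> 0 <= X x <= 1) ->
  (forall k, (m.+1 + k)%:R * E (fun x => X x ^+ k.+1) =
             k.+1%:R * E (fun x => X x ^+ k)) ->
  0 <= s <= 1 ->
  fine (P (D `&` [set x | X x < s])) <= m%:R * s.
Proof.
move=> m0 mX X01 EX s01.
have bX : bounded_meas D X.
  by split=> //; exists 1 => x /X01/andP[X0 X1]; rewrite ger0_norm.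
pose Lm := GRing.isLinear.Build R {poly R} R *%R
  (fun p : {poly R} => E (fun x => p.[X x])) (expect_horner_linear mD PD bX).
pose L : {scalar {poly R}} := HB.pack (fun p : {poly R} => E (fun x => p.[X x])) Lm.
have LXk k : L 'X^k = E (fun x => X x ^+ k).
  by apply: eq_Rintegral => x _; rewrite hornerXn.
have LX k : (m.+1 + k)%:R * L 'X^(k.+1) = k.+1%:R * L 'X^k.
  by rewrite !LXk EX.
have L1 : L 1 = 1.
  by rewrite -[RHS](expect_cst mD PD); apply: eq_Rintegral => x _; rewrite hornerC.
have mon := jacobi_moments LX _ m0 L1.
pose V x := (1 - X x) ^+ m.
have mV : measurable_fun D V.
  by apply: measurable_funX; apply: measurable_funB => //; exact: measurable_cst.
have V01 x : D x -> 0 <= V x <= 1.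
  move=> /X01/andP[X0 X1].
  by rewrite exprn_ge0 ?subr_ge0// exprn_ile1 ?subr_ge0 ?lerBlDr ?lerDl.
have EV k : E (fun x => V x ^+ k) = k.+1%:R^-1.
  have -> : E (fun x => V x ^+ k) = L ((1 - 'X) ^+ (m * k)).
    by apply: eq_Rintegral => x _; rewrite /V -exprM !hornerE.
  rewrite mon -mulnS natrM invfM mulrA divff ?mul1r//.
  by rewrite pnatr_eq0 -lt0n.
apply: (le_trans _ (onem_exp_le m s01)).
have v1 : (1 - s) ^+ m <= 1.
  by move: s01 => /andP[s0 s1]; rewrite exprn_ile1 ?subr_ge0 ?lerBlDr ?lerDl.
apply: (le_trans _ (uniform_tail mD PD mV V01 EV v1)).
have mge := measurable_preimage_ge mD _ mV.
have mle : measurable (D `&` [set x | X x < s]).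
  by rewrite -preimage_itvNyo; apply: mX => //; exact: measurable_itv.
apply: fine_le; [exact: fin_num_measure|exact: fin_num_measure|].
apply: le_measure; rewrite ?inE//.
move=> x [Dx /= Xs]; split=> //=.
by move: s01 (X01 x Dx) Xs => /andP[s0 s1] /andP[X0 X1] Xs; rewrite lerXn2r ?nnegrE; lra.
Qed.

End BetaTail.

(** * Coefficients of powers of a random quadratic polynomial *)

Section QuadPower.
Context (R : comNzRingType).
Definition quad (a b c : R) : {poly R} := a%:P + b *: 'X + c *: 'X^2.

Lemma horner_quad a b c x : (quad a b c).[x] = a + b * x + c * x ^+ 2.
Proof. by rewrite /quad !hornerE. Qed.

Lemma coef_mul_quad a b c (p : {poly R}) j :
  (quad a b c * p)`_j.+2 = a * p`_j.+2 + b * p`_j.+1 + c * p`_j.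
Proof.
rewrite /quad !mulrDl !coefD -!scalerAl coefCM !coefZ.
by rewrite !coefXM coefXnM /= subn2.
Qed.

Lemma coef_mul_quad0 a b c (p : {poly R}) :
  (quad a b c * p)`_0 = a * p`_0.
Proof.
rewrite /quad !mulrDl !coefD -!scalerAl coefCM !coefZ.
by rewrite !coefXM coefXnM /= !mulr0 !addr0.
Qed.

Lemma coef_mul_quad1 a b c (p : {poly R}) :
  (quad a b c * p)`_1 = a * p`_1 + b * p`_0.
Proof.
rewrite /quad !mulrDl !coefD -!scalerAl coefCM !coefZ.
by rewrite !coefXM coefXnM /= !mulr0 !addr0.
Qed.

Lemma coef0_quadX a b c k : (quad a b c ^+ k)`_0 = a ^+ k.
Proof.
elim: k => [|k IH]; first by rewrite !expr0 coef1.
by rewrite !exprS coef_mul_quad0 IH.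
Qed.

Lemma coef1_quadX a b c k : (quad a b c ^+ k.+1)`_1 = k.+1%:R * a ^+ k * b.
Proof.
elim: k => [|k IH].
  by rewrite exprS coef_mul_quad1 expr0 !coef1 /= expr0; ring.
by rewrite exprS coef_mul_quad1 IH coef0_quadX -[k.+2%:R]natr1 !exprS; ring.
Qed.

(** For [k = 0] the exponent [k.-1] is harmless because the binomial coefficient
in front of it vanishes. *)
Lemma coef2_quadX a b c k : (quad a b c ^+ k.+1)`_2 =
  k.+1%:R * a ^+ k * c + 'C(k.+1, 2)%:R * a ^+ k.-1 * b ^+ 2.
Proof.
elim: k => [|k IH].
  by rewrite exprS coef_mul_quad expr0 !coef1 /= bin_small// expr0; ring.
rewrite exprS coef_mul_quad IH coef1_quadX coef0_quadX [in RHS]binS bin1 natrD.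
rewrite -[k.+2%:R]natr1 -[k.+1.-1]/k.
case: k {IH} => [|k]; first by rewrite (bin_small (ltnSn 1)) /=; ring.
by rewrite -[k.+1.-1]/k !exprS; ring.
Qed.

(** The bound only has to be uniform in the coefficients, so that the random
polynomials share one finite expansion. *)
Lemma size_quadX a b c k : (size (quad a b c ^+ k) <= (2 * k).+1)%N.
Proof.
elim: k => [|k IH]; first by rewrite expr0 size_poly1.
rewrite exprS mulnS; apply/leq_sizeP => -[//|[//|j]] kj; rewrite coef_mul_quad.
have {}kj : ((2 * k).+1 <= j)%N := kj.
by rewrite !(leq_sizeP _ _ IH) ?mulr0 ?addr0// !leqW.
Qed.

End QuadPower.

Section ExpectQuad.
Context (R : realType) (dT : measure_display) (T : measurableType dT).
Context (P : probability T R) (D : set T).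
Hypotheses (mD : measurable D) (PD : P D = 1%E).
Local Notation E f := (\int[P]_(x in D) f x).
Context (f g h : T -> R).
Hypotheses (bf : bounded_meas D f) (bg : bounded_meas D g)
  (bh : bounded_meas D h).

Lemma bounded_meas_coef_quadX k j :
  bounded_meas D (fun x => (quad (f x) (g x) (h x) ^+ k)`_j).
Proof.
elim: k j => [|k IH] j.
  rewrite (_ : (fun _ => _) = fun=> (j == 0%N)%:R); first exact: bounded_meas_cst.
  by apply/funext => x; rewrite expr0 coef1.
case: j => [|[|j]].
- rewrite (_ : (fun _ => _) = fun x => f x * (quad (f x) (g x) (h x) ^+ k)`_0).
    exact: bounded_measM.
  by apply/funext => x; rewrite exprS coef_mul_quad0.
- rewrite (_ : (fun _ => _) = fun x => f x * (quad (f x) (g x) (h x) ^+ k)`_1 +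
     g x * (quad (f x) (g x) (h x) ^+ k)`_0).
    by apply: bounded_measD; exact: bounded_measM.
  by apply/funext => x; rewrite exprS coef_mul_quad1.
- rewrite (_ : (fun _ => _) = fun x => f x * (quad (f x) (g x) (h x) ^+ k)`_j.+2 +
     g x * (quad (f x) (g x) (h x) ^+ k)`_j.+1 +
     h x * (quad (f x) (g x) (h x) ^+ k)`_j).
    by apply: bounded_measD; [apply: bounded_measD|]; exact: bounded_measM.
  by apply/funext => x; rewrite exprS coef_mul_quad.
Qed.

(** If the mean of [(f + g r + h r^2)^k] is [c (1 + r^2)^k] for every real [r],
then the coefficients agree, since a polynomial with infinitely many roots
is zero. *)
Lemma expect_coef_quadX k c :
  (forall r : R, E (fun x => (f x + g x * r + h x * r ^+ 2) ^+ k) =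
     c * (1 + r ^+ 2) ^+ k) ->
  forall j, E (fun x => (quad (f x) (g x) (h x) ^+ k)`_j) =
    c * (quad 1 0 1 ^+ k)`_j.
Proof.
move=> H j; set N := (2 * k).+1.
pose p := \poly_(i < N) E (fun x => (quad (f x) (g x) (h x) ^+ k)`_i).
pose q := c *: (quad 1 0 1 ^+ k : {poly R}).
have pq : p = q.
  apply/eqP; rewrite -subr_eq0; apply/negPn/negP => pq0.
  pose rs := [seq (i%:R : R) | i <- iota 0 (size (p - q)%R)].
  have rs_root : all (root (p - q)) rs.
    apply/allP => _ /mapP[i _ ->]; rewrite rootE hornerD hornerN subr_eq0; apply/eqP.
    rewrite /q hornerZ [in RHS]horner_exp horner_quad mul0r addr0 mul1r -H.
    rewrite /p horner_poly.
    transitivity (E (fun x => \sum_(j < N)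
        (i%:R : R) ^+ j * (quad (f x) (g x) (h x) ^+ k)`_j)).
      rewrite (expect_sum mD PD); last first.
        move=> n; apply: bounded_measM; first exact: bounded_meas_cst.
        exact: bounded_meas_coef_quadX.
      apply: eq_bigr => n _; rewrite (expectZ mD PD) 1?mulrC//.
      exact: bounded_meas_coef_quadX.
    apply: eq_Rintegral => x _.
    rewrite -horner_quad -horner_exp (horner_coef_wide _ (size_quadX _ _ _ _)).
    by apply: eq_bigr => n _; rewrite mulrC.
  have rs_uniq : uniq rs.
    by rewrite map_inj_uniq ?iota_uniq//; apply: mulrIn; rewrite oner_eq0.
  by have := max_poly_roots pq0 rs_root rs_uniq; rewrite size_map size_iota ltnn.
rewrite -coefZ -/q -pq coef_poly; case: ltnP => // Nj.
rewrite -[RHS](expect_cst mD PD); apply: eq_Rintegral => x _.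
by apply: (leq_sizeP _ _ (size_quadX _ _ _ _)).
Qed.

End ExpectQuad.

(** * Borel measurability on the complex space *)

Lemma normc_ge_Im (R : rcfType) (z : R[i]) : `|complex.Im z|%:C <= `|z|.
Proof.
rewrite normc_def lecR -sqrtr_sqr ler_wsqrtr// lerDr sqr_ge0 //.
Qed.

Lemma continuous_Re (R : realType) : continuous (@complex.Re R).
Proof.
move=> z A /nbhs_ballP[e e0 sub]; apply/nbhs_ballP; exists e%:C => /=.
  by rewrite ltcR.
move=> y; rewrite -ball_normE /= => zy; apply: sub; rewrite -ball_normE /=.
by rewrite -raddfB -ltcR (le_lt_trans (normc_ge_Re _))//.
Qed.

Lemma continuous_Im (R : realType) : continuous (@complex.Im R).
Proof.
move=> z A /nbhs_ballP[e e0 sub]; apply/nbhs_ballP; exists e%:C => /=.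
  by rewrite ltcR.
move=> y; rewrite -ball_normE /= => zy; apply: sub; rewrite -ball_normE /=.
by rewrite -raddfB -ltcR (le_lt_trans (normc_ge_Im _))//.
Qed.

Lemma continuous_measurable_borelC (R : realType) (d : nat)
    (f : 'rV[R[i]]_d -> R) :
  continuous f -> measurable_fun setT (f : borelC R d -> R).
Proof.
move=> /continuousP cf; apply: (measurability _ (RGenOpens.measurableE R)).
move=> _ [_ [a [b ->] <-]]; rewrite setTI.
by apply: sub_sigma_algebra; apply: cf; exact: interval_open.
Qed.

Lemma measurable_Re_coord (R : realType) (d : nat) (l : 'I_d) :
  measurable_fun setT ((fun x : 'rV[R[i]]_d => complex.Re (x 0 l))
    : borelC R d -> R).
Proof.
apply: continuous_measurable_borelC => x.
by apply: continuous_comp; [exact: coord_continuous|exact: continuous_Re].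
Qed.

Lemma measurable_Im_coord (R : realType) (d : nat) (l : 'I_d) :
  measurable_fun setT ((fun x : 'rV[R[i]]_d => complex.Im (x 0 l))
    : borelC R d -> R).
Proof.
apply: continuous_measurable_borelC => x.
by apply: continuous_comp; [exact: coord_continuous|exact: continuous_Im].
Qed.

(** * Squared moduli as real-valued functions *)

Section SqMod.
Context (R : realType).

(** The square of the complex modulus with values in the real field, so that the
integration theory of real functions applies. *)
Definition sqmod (z : R[i]) : R := complex.Re z ^+ 2 + complex.Im z ^+ 2.

Lemma sqmodE z : (sqmod z)%:C = `|z| ^+ 2.
Proof. exact: add_Re2_Im2. Qed.

Lemma sqmod_ge0 z : 0 <= sqmod z.
Proof. by rewrite addr_ge0 ?sqr_ge0. Qed.

Lemma sqmod_conj z : sqmod z^* = sqmod z.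
Proof. by case: z => a b; rewrite /sqmod /= sqrrN. Qed.

Lemma sqmodM z w : sqmod (z * w) = sqmod z * sqmod w.
Proof. by case: z w => a b [c d]; rewrite /sqmod /=; ring. Qed.

Lemma sqmod_real (r : R) : sqmod r%:C = r ^+ 2.
Proof. by rewrite /sqmod /= expr0n addr0. Qed.

Context (d : nat).
Implicit Types a x : 'rV[R[i]]_d.

Definition sqnorm x : R := \sum_l sqmod (x 0 l).

Lemma dotmx_sumE a x : dotmx a x = \sum_l a 0 l * (x 0 l)^*.
Proof. by rewrite dotmxE mxE; apply: eq_bigr => l _; rewrite !mxE. Qed.

Lemma dotmx_sqnorm x : dotmx x x = (sqnorm x)%:C.
Proof.
rewrite dotmx_sumE rmorph_sum /=; apply: eq_bigr => l _.
by rewrite sqmodE sqr_normc.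
Qed.

Lemma sqnorm_ge0 x : 0 <= sqnorm x.
Proof. by apply: sumr_ge0 => l _; exact: sqmod_ge0. Qed.

Lemma eucl_normE x : eucl_norm x = (Num.sqrt (sqnorm x))%:C.
Proof.
rewrite /eucl_norm dotmx_sqnorm -[in LHS](sqr_sqrtr (sqnorm_ge0 x)) rmorphXn.
by rewrite sqrCK// lecR sqrtr_ge0.
Qed.

Lemma csphereP x : csphere x <-> sqnorm x = 1.
Proof.
rewrite /csphere /= eucl_normE; split => [/complexI h|->].
  by rewrite -(sqr_sqrtr (sqnorm_ge0 x)) h expr1n.
by rewrite sqrtr1.
Qed.

Definition sqdot a x : R := sqmod (dotmx a x).

Lemma sqdotZ (c : R) a x : sqdot (c%:C *: a) x = c ^+ 2 * sqdot a x.
Proof. by rewrite /sqdot linearZl_LR /= sqmodM sqmod_real. Qed.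

Lemma sqnormZ (c : R) a : sqnorm (c%:C *: a) = c ^+ 2 * sqnorm a.
Proof.
rewrite /sqnorm mulr_sumr; apply: eq_bigr => l _.
by rewrite mxE sqmodM sqmod_real.
Qed.

Lemma Re_dotmx a x : complex.Re (dotmx a x) = \sum_l
  (complex.Re (a 0 l) * complex.Re (x 0 l) + complex.Im (a 0 l) * complex.Im (x 0 l)).
Proof.
rewrite dotmx_sumE raddf_sum /=; apply: eq_bigr => l _.
by case: (a 0 l) (x 0 l) => b c [e f] /=; ring.
Qed.

Lemma Im_dotmx a x : complex.Im (dotmx a x) = \sum_l
  (complex.Im (a 0 l) * complex.Re (x 0 l) - complex.Re (a 0 l) * complex.Im (x 0 l)).
Proof.
rewrite dotmx_sumE raddf_sum /=; apply: eq_bigr => l _.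
by case: (a 0 l) (x 0 l) => b c [e f] /=; ring.
Qed.

Lemma measurable_sqmod_coord (l : 'I_d) :
  measurable_fun setT ((fun x => sqmod (x 0 l)) : borelC R d -> R).
Proof.
apply: measurable_funD; apply: measurable_funX.
  exact: measurable_Re_coord.
exact: measurable_Im_coord.
Qed.

Lemma measurable_sqdot a : measurable_fun setT (sqdot a : borelC R d -> R).
Proof.
rewrite /sqdot /sqmod; apply: measurable_funD; apply: measurable_funX.
  under eq_fun do rewrite Re_dotmx.
  apply: measurable_sum => l; apply: measurable_funD.
    by apply: measurable_funM; [exact: measurable_cst|exact: measurable_Re_coord].
  by apply: measurable_funM; [exact: measurable_cst|exact: measurable_Im_coord].
under eq_fun do rewrite Im_dotmx.
apply: measurable_sum => l; apply: measurable_funB.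
  by apply: measurable_funM; [exact: measurable_cst|exact: measurable_Re_coord].
by apply: measurable_funM; [exact: measurable_cst|exact: measurable_Im_coord].
Qed.

Lemma measurable_csphere : measurable (csphere : set (borelC R d)).
Proof.
rewrite (_ : csphere = (fun x => sqnorm x) @^-1` [set 1]); last first.
  by apply/funext => x; apply/propext; exact: csphereP.
rewrite -[X in measurable X]setTI.
apply: (_ : measurable_fun setT (sqnorm : borelC R d -> R)) => //.
by apply: measurable_sum => l; exact: measurable_sqmod_coord.
Qed.

End SqMod.

Section UnitaryBasis.
Local Open Scope sesquilinear_scope.

(** The unitary group acts transitively on the sphere: Gram-Schmidt applied to
the matrix with first row [a] and other rows zero gives a unitary [S] whose first
row is [a], and its adjoint is the matrix required. *)
Lemma unitary_to_basis (R : realType) n (a : 'rV[R[i]]_n.+1) : sqnorm a = 1 ->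
  exists2 U : 'M[R[i]]_n.+1, U \is unitarymx &
    forall x, dotmx (delta_mx 0 0) (x *m U) = dotmx a x.
Proof.
move=> a1; pose A : 'M[R[i]]_n.+1 := \matrix_(i, j) ((i == 0)%:R * a 0 j).
pose S := schmidt A.
have A0 : row 0 A = a by apply/rowP => j; rewrite !mxE eqxx mul1r.
have uS : S \is unitarymx by exact: schmidt_unitarymx.
have := row_schmidt_sub A 0; rewrite (big_pred1 ord0); last first.
  by move=> k; rewrite leqn0.
rewrite A0 genmxE => /sub_rVP[c ac].
have s1 : dotmx (row 0 S) (row 0 S) = 1.
  by rewrite (row_unitarymxP uS) eqxx.
(* Gram-Schmidt fixes the phase, hence [c] is [1] and not merely of modulus
   one. *)
have c0 : 0 <= c.
  have := form1_row_schmidt A 0; rewrite A0 ac linearZl_LR /= -/S.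
  by rewrite [dotmx _ _]s1 mulr1.
have c1 : c = 1.
  have : dotmx a a = 1 by rewrite dotmx_sqnorm a1.
  rewrite ac linearZl_LR linearZr_LR /= [dotmx _ _]s1 mulr1.
  rewrite -normCK ger0_norm// => c21; apply/eqP.
  by rewrite -(eqrXn2 (n := 2))// expr1n c21.
exists (S ^t* ); first by rewrite trmxC_unitary.
move=> x; rewrite !dotmxE trmx_mul map_mxM /= trmxCK mulmxA -rowE.
by rewrite ac c1 scale1r.
Qed.

End UnitaryBasis.

(** * Moments of an invariant measure on the sphere *)

Section InvariantMoments.
Context (R : realType) (n : nat).
Context (Q : probability (borelC R n.+1) R).
Hypothesis hQ : unitarily_invariant_on_sphere Q.
Local Notation C := R[i].
Local Notation S := (csphere : set (borelC R n.+1)).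
Local Notation E f := (\int[Q]_(x in S) f x).
Local Notation e0 := (delta_mx 0 0 : 'rV[R[i]]_n.+1).
Implicit Types a x : 'rV[R[i]]_n.+1.

Let QS : Q S = 1%E := hQ.1.
Let mS : measurable S := measurable_csphere (R := R) (d := n.+1).

Lemma sqdot_e0 x : sqdot e0 x = sqmod (x 0 0).
Proof.
rewrite /sqdot dotmx_sumE (bigD1 ord0)//= big1 ?addr0.
  by rewrite mxE !eqxx mul1r sqmod_conj.
by move=> l /negbTE l0; rewrite mxE l0 andbF mul0r.
Qed.

Lemma sqdot_law a (B : set R) : sqnorm a = 1 -> measurable B ->
  Q (sqdot a @^-1` B) = Q ((fun x => sqmod (x 0 0)) @^-1` B).
Proof.
move=> a1 mB; have [U uU Ua] := unitary_to_basis a1.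
have mB0 : measurable ((fun x => sqmod (x 0 0)) @^-1` B : set (borelC R n.+1)).
  by rewrite -[X in measurable X]setTI; apply: (measurable_sqmod_coord 0).
apply: etrans (hQ.2 U uU _ mB0); congr (Q _); apply/funext => x.
by rewrite /preimage /= -sqdot_e0 /sqdot Ua.
Qed.

Lemma sqmod_coord_le1 x l : S x -> sqmod (x 0 l) <= 1.
Proof.
move=> /csphereP <-; rewrite /sqnorm (bigD1 l)//= lerDl.
by apply: sumr_ge0 => ? _; exact: sqmod_ge0.
Qed.

Lemma bounded_Re l : bounded_meas S (fun x => complex.Re (x 0 l)).
Proof.
split; first by apply: measurable_funTS; exact: measurable_Re_coord.
exists 1 => x Sx; have x1 := sqmod_coord_le1 l Sx.
rewrite -(expr_le1 (n := 2))// real_normK ?num_real//.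
by apply: le_trans x1; rewrite lerDl sqr_ge0.
Qed.

Lemma bounded_Im l : bounded_meas S (fun x => complex.Im (x 0 l)).
Proof.
split; first by apply: measurable_funTS; exact: measurable_Im_coord.
exists 1 => x Sx; have x1 := sqmod_coord_le1 l Sx.
rewrite -(expr_le1 (n := 2))// real_normK ?num_real//.
by apply: le_trans x1; rewrite lerDr sqr_ge0.
Qed.

Lemma bounded_sqmod_coord l : bounded_meas S (fun x => sqmod (x 0 l)).
Proof.
by apply: bounded_measD; apply: bounded_measX;
  [exact: bounded_Re|exact: bounded_Im].
Qed.

Lemma bounded_sqdot a : bounded_meas S (sqdot a).
Proof.
apply: bounded_measD; apply: bounded_measX.
  under eq_fun do rewrite Re_dotmx.
  by apply: bounded_meas_sum => l; apply: bounded_measD;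
    (apply: bounded_measM; first exact: bounded_meas_cst);
    [exact: bounded_Re|exact: bounded_Im].
under eq_fun do rewrite Im_dotmx.
apply: bounded_meas_sum => l; apply: bounded_measD.
  by apply: bounded_measM; [exact: bounded_meas_cst|exact: bounded_Re].
under eq_fun do rewrite -mulNr.
by apply: bounded_measM; [exact: bounded_meas_cst|exact: bounded_Im].
Qed.

(** Homogeneity reduces the claim to a unit vector, where the law does not
depend on the direction. *)
Lemma sqdot_moment a k : 0 < sqnorm a ->
  E (fun x => sqdot a x ^+ k) =
  E (fun x => sqmod (x 0 0) ^+ k) * sqnorm a ^+ k.
Proof.
move=> a0; pose r := Num.sqrt (sqnorm a).
have r2 : r ^+ 2 = sqnorm a by rewrite sqr_sqrtr// ltW.
have r0 : 0 < r by rewrite sqrtr_gt0.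
pose u := (r^-1)%:C *: a.
have u1 : sqnorm u = 1 by rewrite sqnormZ exprVn r2 mulVf// gt_eqF.
have au : a = r%:C *: u.
  by rewrite /u scalerA -rmorphM/= divff ?gt_eqF// rmorph1 scale1r.
clearbody u.
have uE : E (fun x => sqdot u x ^+ k) = E (fun x => sqmod (x 0 0) ^+ k).
  apply: (expect_law mS QS).
  - exact: measurable_sqdot.
  - exact: measurable_sqmod_coord.
  - by move=> x; exact: sqmod_ge0.
  - by move=> x; exact: sqmod_ge0.
  - by move=> B mB; exact: sqdot_law.
rewrite -uE -(expectZr mS QS); last exact/bounded_measX/bounded_sqdot.
apply: eq_expect => x _.
by rewrite {1}au sqdotZ r2 exprMn mulrC.
Qed.

(** The coefficient of [r] depends on the phase [z], those of [1] and [r^2] do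
not; averaging over phases will remove the cross terms. *)
Lemma sqdot_e0D (z : C) (r : R) l x : l != 0 -> sqmod z = 1 ->
  sqdot (e0 + (r%:C * z) *: delta_mx 0 l) x =
  sqmod (x 0 0) + 2 * complex.Re (z * x 0 0 * (x 0 l)^*) * r
  + sqmod (x 0 l) * r ^+ 2.
Proof.
move=> l0 z1; rewrite /sqdot dotmx_sumE (bigD1 ord0)//= (bigD1 l)//= big1 ?addr0.
  rewrite !mxE !eqxx !(eq_sym 0 l) (negbTE l0) /= mulr0 addr0 add0r mulr1 mul1r.
  case: z z1 (x 0 0) (x 0 l) => [p q] pq [a b] [c e]; rewrite /sqmod /= in pq *.
  rewrite -[r ^+ 2]mul1r -{2}pq; ring.
by move=> k /andP[/negbTE k0 /negbTE kl]; rewrite !mxE k0 kl !andbF mulr0 addr0 mul0r.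
Qed.

Lemma sqnorm_e0D (z : C) (r : R) (l : 'I_n.+1) : l != 0 -> sqmod z = 1 ->
  sqnorm (e0 + (r%:C * z) *: delta_mx 0 l) = 1 + r ^+ 2.
Proof.
move=> l0 z1; rewrite /sqnorm (bigD1 ord0)//= (bigD1 l)//= big1 ?addr0.
  rewrite !mxE !eqxx !(eq_sym 0 l) (negbTE l0) /= mulr0 addr0 add0r mulr1.
  by rewrite sqmodM z1 sqmod_real mulr1 /sqmod /= expr0n addr0 expr1n.
move=> k /andP[/negbTE k0 /negbTE kl]; rewrite !mxE k0 kl !andbF mulr0 addr0.
by rewrite /sqmod /= expr0n addr0.
Qed.

Lemma bounded_cross (z : C) l :
  bounded_meas S (fun x => 2 * complex.Re (z * x 0 0 * (x 0 l)^*)).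
Proof.
rewrite (_ : (fun _ => _) = fun x =>
  2 * (complex.Re z * (complex.Re (x 0 0) * complex.Re (x 0 l)
     + complex.Im (x 0 0) * complex.Im (x 0 l))
   + complex.Im z * (complex.Re (x 0 0) * complex.Im (x 0 l)
     + (- 1) * (complex.Im (x 0 0) * complex.Re (x 0 l))))); last first.
  apply/funext => x; case: z (x 0 0) (x 0 l) => [p q] [a b] [c e] /=; ring.
have bRe := bounded_Re; have bIm := bounded_Im; have bc := bounded_meas_cst.
by do !(apply: bounded_measM || apply: bounded_measD) => //; exact: bc.
Qed.

(** The coefficient of [r^2] in the moment of order [k+1] along
[e_0 + r z e_l] is [(k+1) X^k Y + C(k+1, 2) X^(k-1) G_z^2], where [X] and [Y] are
the squared moduli of the two coordinates and [G_z] is the cross term.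
Since [G_1^2 + G_i^2 = 4 X Y], adding the cases [z = 1] and [z = i] leaves
only the mean of [X^k Y]. *)
Lemma mixed_moment (l : 'I_n.+1) k : l != 0 ->
  k.+1%:R * E (fun x => sqmod (x 0 0) ^+ k * sqmod (x 0 l)) =
  E (fun x => sqmod (x 0 0) ^+ k.+1).
Proof.
move=> l0.
set A := fun x : 'rV[C]_n.+1 => sqmod (x 0 0).
set B := fun x : 'rV[C]_n.+1 => sqmod (x 0 l).
pose G z := fun x : 'rV[C]_n.+1 => 2 * complex.Re (z * x 0 0 * (x 0 l)^*).
have bA : bounded_meas S A by exact: bounded_sqmod_coord.
have bB : bounded_meas S B by exact: bounded_sqmod_coord.
have coefz z : sqmod z = 1 ->
    k.+1%:R * E (fun x => A x ^+ k * B x) +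
    'C(k.+1, 2)%:R * E (fun x => A x ^+ k.-1 * G z x ^+ 2) =
    E (fun x => A x ^+ k.+1) * k.+1%:R.
  move=> z1; have bG : bounded_meas S (G z) by exact: bounded_cross.
  have H (r : R) : E (fun x => (A x + G z x * r + B x * r ^+ 2) ^+ k.+1) =
      E (fun x => A x ^+ k.+1) * (1 + r ^+ 2) ^+ k.+1.
    transitivity
      (E (fun x => sqdot (e0 + (r%:C * z) *: delta_mx 0 l) x ^+ k.+1)).
      by apply: eq_Rintegral => x _; rewrite (sqdot_e0D _ _ l0 z1).
    by rewrite sqdot_moment (sqnorm_e0D _ l0 z1)// ltr_pwDl// sqr_ge0.
  have := expect_coef_quadX mS QS bA bG bB H 2.
  rewrite coef2_quadX !expr1n expr0n /= !mulr0 addr0 !mulr1 => <-.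
  rewrite -!(expectZ mS QS); last 2 first.
  - by apply: bounded_measM => //; exact: bounded_measX.
  - by apply: bounded_measM => //; exact: bounded_measX.
  rewrite -(expectD mS QS); last 2 first.
  - apply: bounded_measM; first exact: bounded_meas_cst.
    by apply: bounded_measM => //; exact: bounded_measX.
  - apply: bounded_measM; first exact: bounded_meas_cst.
    by apply: bounded_measM; exact: bounded_measX.
  by apply: eq_Rintegral => x _; rewrite coef2_quadX !mulrA.
have i1 : sqmod ('i%C : C) = 1 by rewrite /sqmod /= expr0n add0r expr1n.
have o1 : sqmod (1 : C) = 1 by rewrite /sqmod /= expr0n addr0 expr1n.
have GG : 'C(k.+1, 2)%:R * E (fun x => A x ^+ k.-1 * G 1 x ^+ 2) +
    'C(k.+1, 2)%:R * E (fun x => A x ^+ k.-1 * G 'i%C x ^+ 2) =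
    'C(k.+1, 2)%:R * 4 * E (fun x => A x ^+ k * B x).
  rewrite -mulrDr -mulrA.
  case: k {coefz} => [|k]; first by rewrite bin_small// !mul0r.
  congr (_ * _).
  rewrite -(expectD mS QS); last 2 first.
  - by apply: bounded_measM; apply: bounded_measX => //; exact: bounded_cross.
  - by apply: bounded_measM; apply: bounded_measX => //; exact: bounded_cross.
  rewrite -(expectZ mS QS); last first.
    by apply: bounded_measM => //; exact: bounded_measX.
  apply: eq_Rintegral => x _; rewrite /G /A /B -[k.+1.-1]/k.
  rewrite [_ ^+ k.+1]exprS; move: (sqmod (x 0 0) ^+ k) => t.
  case: (x 0 0) (x 0 l) => [a b] [c e]; rewrite /sqmod /=; ring.
have C2 : 'C(k.+1, 2)%:R * 2 = k.+1%:R * k%:R :> R.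
  rewrite -!natrM; congr (_%:R).
  by rewrite mulnC mul_bin_left bin1 subn1 mulnC.
have h1 := coefz _ o1; have h2 := coefz _ i1.
move: h1 h2 GG; rewrite -/A -/B.
set M := E (fun x => A x ^+ k * B x); set c := E (fun x => A x ^+ k.+1).
set U1 := _ * E (fun x => _ * G 1 x ^+ 2).
set U2 := _ * E (fun x => _ * G 'i%C x ^+ 2).
move=> h1 h2 GG; have k0 : k.+1%:R != 0 :> R by rewrite pnatr_eq0.
apply: (mulfI k0).
have e1 : 'C(k.+1, 2)%:R * 4 * M = 2 * (k.+1%:R * k%:R * M) by rewrite -C2; ring.
have e2 : k.+1%:R * (k.+1%:R * M) = k.+1%:R * M + k.+1%:R * k%:R * M.
  by rewrite -{2}natr1; ring.
by rewrite e2; lra.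
Qed.

(** On the sphere the coordinates other than the first contribute
[1 - X] in total. *)
Lemma moment_rec k :
  (n.+1 + k)%:R * E (fun x => sqmod (x 0 0) ^+ k.+1) =
  k.+1%:R * E (fun x => sqmod (x 0 0) ^+ k).
Proof.
set A := fun x : 'rV[C]_n.+1 => sqmod (x 0 0).
have bA : bounded_meas S A by exact: bounded_sqmod_coord.
have bAk j : bounded_meas S (fun x => A x ^+ j) by exact: bounded_measX.
have -> : E (fun x => A x ^+ k) = E (fun x => A x ^+ k.+1) +
    \sum_(l < n) E (fun x => A x ^+ k * sqmod (x 0 (lift ord0 l))).
  rewrite -(expect_sum mS QS); last first.
    by move=> l; apply: bounded_measM => //; exact: bounded_sqmod_coord.
  rewrite -(expectD mS QS) => [|//|]; last first.
    apply: bounded_meas_sum => l.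
    by apply: bounded_measM => //; exact: bounded_sqmod_coord.
  apply: eq_expect => x /csphereP; rewrite /sqnorm big_ord_recl => x1.
  by rewrite -mulr_sumr exprSr -mulrDr x1 mulr1.
rewrite mulrDr mulr_sumr.
rewrite (eq_bigr (fun=> E (fun x => A x ^+ k.+1))); last first.
  by move=> l _; exact: mixed_moment.
rewrite sumr_const card_ord -[_ *+ n]mulr_natl -mulrDl; congr (_ * _).
by rewrite -natrD addnC addSnnS.
Qed.

Lemma sqdot_tail a s : sqnorm a = 1 -> 0 <= s <= 1 ->
  fine (Q [set x | sqdot a x < s]) <= n%:R * s.
Proof.
move=> a1 s01.
have -> : Q [set x | sqdot a x < s] = Q (S `&` [set x | sqmod (x 0 0) < s]).
  have mX := measurable_preimage_lt s (@measurable_sqmod_coord R n.+1 0).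
  apply: etrans (esym (measure_setI_full mS QS mX)).
  by have := sqdot_law a1 (measurable_itv `]-oo, s[); rewrite 2!preimage_itvNyo.
have [n0|n0] := posnP n; last first.
  apply: (beta_tail mS QS n0) => //.
  - exact: (measurable_funTS (measurable_sqmod_coord _)).
  - by move=> x Sx; rewrite sqmod_ge0 sqmod_coord_le1.
  - exact: moment_rec.
(* In dimension one [|mu_0|^2 = 1] on the sphere, which is not below [s]. *)
have -> : n%:R * s = 0 :> R by rewrite n0 mul0r.
have -> : S `&` [set x | sqmod (x 0 0) < s] = set0; last by rewrite measure0.
apply/seteqP; split => // x [/csphereP + /=].
rewrite /sqnorm big_ord_recl big1 ?addr0 => [->|l _]; last first.
  by case: l => l ln; have := ln; rewrite [X in (_ < X)%N]n0.
by move: s01 => /andP[_ s1]; rewrite ltNge s1.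
Qed.

Lemma sqdot_small_ball a e : sqnorm a = 1 -> 0 <= e <= 1 ->
  (Q [set x | (sqdot a x < e ^+ 2)%R]
   <= (2 * Num.sqrt (n.+1%:R / pi) * e)%:E)%E.
Proof.
move=> a1 /andP[e0 e1]; set A : set (borelC R n.+1) := [set x | _].
have mA : measurable A := measurable_preimage_lt _ (measurable_sqdot a).
have PA : Q A \is a fin_num := fin_num_measure Q A mA.
rewrite -(fineK PA) lee_fin.
apply: prob_le_sqrt_pi => //; last first.
  by apply: sqdot_tail => //; rewrite sqr_ge0 expr_le1.
by rewrite fine_ge0//= -lee_fin fineK//; exact: probability_le1.
Qed.

End InvariantMoments.

(** * The probability bound *)

(** The law of [X] as a probability on the target, so that facts about an
arbitrary probability on the target apply to it. *)
Lemma probability_preimage d1 d2 (T1 : measurableType d1)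
    (T2 : measurableType d2) (R : realType) (P : probability T1 R)
    (X : {RV P >-> T2}) (A : set T2) :
  P (X @^-1` A) = (distribution P X : probability T2 R) A.
Proof. by []. Qed.

Lemma norm_dotmx_lt (R : realType) d (w x : 'rV[R[i]]_d) (e : R) : 0 <= e ->
  (`|dotmx w x| < e%:C * eucl_norm w) = (sqdot w x < e ^+ 2 * sqnorm w).
Proof.
move=> e0; rewrite eucl_normE normc_def -rmorphM/= ltcR -/(sqmod _).
rewrite -(ltr_pXn2r (n := 2)) ?nnegrE ?mulr_ge0 ?sqrtr_ge0//.
by rewrite exprMn !sqr_sqrtr ?sqmod_ge0 ?sqnorm_ge0.
Qed.

Theorem theorem2p5 (R : realType) (d M : nat) (hd : (1 <= d)%N)
    (t : 'I_M -> 'rV[R]_d)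
    (ht : forall (k : 'I_M) (l : 'I_d), 0 <= t k 0 l < 1)
    (tinj : injective t)
    (i j : 'I_M) (hij : i != j)
    (eps : R) (heps : 0 <= eps <= 1)
    (dO : measure_display) (Omega : measurableType dO)
    (P : probability Omega R) (mu : {RV P >-> borelC R d})
    (hmu : unitarily_invariant_on_sphere (distribution P mu)) :
  (P [set w | (`|lambda (t i) (mu w) - lambda (t j) (mu w)|
                < eps%:C * eucl_norm (zvec (t i) - zvec (t j)))%R]
   <= (2 * Num.sqrt (d%:R / pi) * eps)%:E)%E.
Proof.
case: d hd t ht tinj mu hmu => // n _ t _ _ mu hmu.
move: heps => /andP[e0 e1].
set w := zvec (t i) - zvec (t j).
have lamE x : lambda (t i) x - lambda (t j) x = dotmx w x.
  by rewrite /lambda /w linearBl.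
rewrite (_ : [set _ | _] =
    mu @^-1` [set x | sqdot w x < eps ^+ 2 * sqnorm w]); last first.
  by apply/funext => o; rewrite /preimage /= lamE norm_dotmx_lt.
have [w0|w0] := eqVneq (sqnorm w) 0.
  rewrite w0 mulr0 [X in P X](_ : _ = set0).
    by rewrite measure0 lee_fin !mulr_ge0 ?sqrtr_ge0.
  apply/seteqP; split => // x /=.
  by rewrite ltNge sqmod_ge0.
have wp : 0 < sqnorm w by rewrite lt_def w0 sqnorm_ge0.
pose r := Num.sqrt (sqnorm w).
have r2 : r ^+ 2 = sqnorm w by rewrite sqr_sqrtr// ltW.
pose u := (r^-1)%:C *: w.
have u1 : sqnorm u = 1 by rewrite sqnormZ exprVn r2 mulVf.
have -> : [set x | sqdot w x < eps ^+ 2 * sqnorm w] = [set x | sqdot u x < eps ^+ 2].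
  apply/funext => x /=.
  by rewrite /u sqdotZ exprVn r2 [_^-1 * _]mulrC ltr_pdivrMr.
rewrite probability_preimage.
by apply: (sqdot_small_ball hmu u1); rewrite e0.
Qed.
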